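(* Let $x$ be a positive rational number, and suppose that $x^x \in \mathbb{Q}$. Then $x \in \mathbb{Z}$.
   Context: Here $x^x$ denotes the positive real number $\exp(x \log x)$. *)

(* Defs.v *)
From mathcomp Require Export all_boot all_order all_algebra.
From mathcomp Require Export all_classical reals sequences exp.

Set Implicit Arguments.
Unset Strict Implicit.
Unset Printing Implicit Defensive.

(* Main.v *)
Require Import Defs.
From mathcomp Require Import all_boot all_order all_algebra.
From mathcomp Require Import all_classical reals sequences exp.

Import Order.TTheory GRing.Theory Num.Theory.
Local Open Scope ring_scope.

(** Write [x = a / b] and [x^x = c / d] in lowest terms, with positive [b] and
    [d].  Raising [x^x] to the power [b] turns the transcendental hypothesis
    into arithmetic: [(c / d)^b = x^a = a^a / b^a].  Both outer fractions are
    in lowest terms, so their denominators agree: [d^b = b^a]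
    ([lowest_terms_den_inj], through [exp_self_nat_eq]).

    Hence [b^a] is a perfect [b]-th power with [a] coprime to [b]; comparing
    valuations at a prime [p], [b] divides [a * v_p(b)], hence [v_p(b)].  But
    [v_p(b) < b], so [v_p(b) = 0] for every [p], and [b = 1]
    ([coprime_root_self_exp]). *)

(** Each denominator divides the other one, being coprime to its own numerator
    in the cross-multiplied equality. *)
Lemma lowest_terms_den_inj {m n p q : nat} :
  coprime m n -> coprime p q -> (m * q = p * n)%N -> n = q.
Proof.
move=> co_mn co_pq eq_cross; apply/eqP; rewrite eqn_dvd; apply/andP; split.
  by rewrite -(@Gauss_dvdr n m) 1?coprime_sym // eq_cross dvdn_mull.
by rewrite -(@Gauss_dvdr q p) 1?coprime_sym // -eq_cross dvdn_mull.
Qed.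

(** No prime [p] can divide [b]: its valuation in [b] would be a positive
    multiple of [b], whereas [b < p ^ b]. *)
Lemma coprime_root_self_exp {a b d : nat} :
  (0 < b)%N -> coprime a b -> (d ^ b = b ^ a)%N -> b = 1%N.
Proof.
move=> b_gt0 co_ab eq_pow; apply/eqP; rewrite eqn_leq b_gt0 andbT leqNgt.
apply/negP => b_gt1; pose p := pdiv b.
have val_gt0 : (0 < logn p b)%N.
  by rewrite logn_gt0 mem_primes pdiv_prime // b_gt0 pdiv_dvd.
have b_dvd_val : (b %| logn p b)%N.
  rewrite -(@Gauss_dvdr b a) 1?coprime_sym //.
  by rewrite -lognX -eq_pow lognX dvdn_mulr.
by have := dvdn_leq val_gt0 b_dvd_val; rewrite leqNgt ltn_logl.
Qed.

Lemma pos_rational_lowest_terms {R : realType} {x : R} :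
  0 < x -> rational x ->
  exists n d : nat, [/\ (0 < d)%N, coprime n d & x = n%:R / d%:R].
Proof.
move=> x_gt0 [q _ def_x]; move: x_gt0; rewrite -def_x ltr0q => q_gt0.
exists `|numq q|%N, `|denq q|%N; split.
- by rewrite absz_gt0 denq_eq0.
- exact: coprime_num_den.
- rewrite !pmulrn !gez0_abs ?denq_ge0 ?numq_ge0 ?ltW //.
Qed.

(** The [b]-th power of [x^x] is [x^a], because [b x = a]; clearing
    denominators gives an equality of natural numbers. *)
Lemma exp_self_nat_eq {R : realType} {x : R} {a b c d : nat} :
  0 < x -> (0 < b)%N -> (0 < d)%N ->
  x = a%:R / b%:R -> expR (x * ln x) = c%:R / d%:R ->
  (c ^ b * b ^ a = a ^ a * d ^ b)%N.
Proof.
move=> x_gt0 b_gt0 d_gt0 def_x def_xx.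
have b_neq0 : b%:R != 0 :> R by rewrite pnatr_eq0 -lt0n.
have d_neq0 : d%:R != 0 :> R by rewrite pnatr_eq0 -lt0n.
have eq_frac : (c%:R / d%:R) ^+ b = (a%:R / b%:R) ^+ a :> R.
  rewrite -def_xx -def_x -expRM_natl mulrA.
  have -> : b%:R * x = a%:R by rewrite def_x mulrC divfK.
  by rewrite expRM_natl lnK ?posrE.
apply/eqP; rewrite -(eqr_nat R) !natrM !natrX -eqr_div ?expf_neq0 //.
by rewrite -!expr_div_n eq_frac.
Qed.

Theorem theorem2p2 (R : realType) (x : R)
  (hx_pos : 0 < x) (hx_rat : rational x)
  (hxx_rat : rational (expR (x * ln x))) :
  x \is a Num.int.
Proof.
have [a [b [b_gt0 co_ab def_x]]] := pos_rational_lowest_terms hx_pos hx_rat.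
have [c [d [d_gt0 co_cd def_xx]]] :=
  pos_rational_lowest_terms (expR_gt0 _) hxx_rat.
have eq_nat := exp_self_nat_eq hx_pos b_gt0 d_gt0 def_x def_xx.
have eq_den : (d ^ b = b ^ a)%N.
  apply: lowest_terms_den_inj eq_nat; exact/coprimeXl/coprimeXr.
have b1 := coprime_root_self_exp b_gt0 co_ab eq_den.
by rewrite def_x b1 divr1 pmulrn intr_int.
Qed.
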